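(* Let $\mathcal{L}=(L,\wedge,\vee,*,\rightarrowtail,0,1)$ be a BL-algebra. Then the family $T_*$ of all $*$-open subsets of $L$ is a topology on $L$, and the family $\mathbf{T}_*$ of all $*$-open subsets of $L^2$ is a topology on $L^2$.
   Context: A BL-algebra is an algebra $\mathcal{L}=(L,\wedge,\vee,*,\rightarrowtail,0,1)$ of type $(2,2,2,2,0,0)$ such that: (BL1) $(L,\wedge,\vee,0,1)$ is a bounded lattice with greatest element $1$ and smallest element $0$; (BL2) $(L,*,1)$ is an Abelian monoid; (BL3) $c\le a\rightarrowtail b$ iff $c*a\le b$ for all $a,b,c\in L$; (BL4) $a\wedge b=a*(a\rightarrowtail b)$ for all $a,b\in L$; (BL5) $(a\rightarrowtail b)\vee(b\rightarrowtail a)=1$ for all $a,b\in L$. An element $a\in L$ is strongly less than $1$, written $a\ll 1$, if for every $b\in L$, $a\vee b=1$ implies $b=1$. Elements of $L^2$ are written $\mathbf{a}=(a_1,a_2)$. Define $a\leftrightarrow b=(a\rightarrowtail b)*(b\rightarrowtail a)$ for $a,b\in L$ and $\mathbf{a}\Leftrightarrow\mathbf{b}=(a_1\leftrightarrow b_1)*(a_2\leftrightarrow b_2)$ for $\mathbf{a},\mathbf{b}\in L^2$. For $r\in L$ with $r\ll 1$, $a\in L$ and $\mathbf{a}\in L^2$, the $*$-balls are $B_r(a)=\{b\in L: a\leftrightarrow b>r\}$ and $\mathbf{B}_r(\mathbf{a})=\{\mathbf{b}\in L^2:\mathbf{a}\Leftrightarrow\mathbf{b}>r\}$ (where $x>r$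 means $r\le x$ and $r\neq x$). A subset $G\subseteq L$ is $*$-open if for every $a\in G$ there exists $r\in L$ with $r\ll 1$ and $B_r(a)\subseteq G$. A subset $G\subseteq L^2$ is $*$-open if for every $\mathbf{a}\in G$ there exists $r\in L$ with $r\ll 1$ and $\mathbf{B}_r(\mathbf{a})\subseteq G$. *)

(* Defs.v *)
From HB Require Import structures.
From mathcomp Require Import all_boot all_order.
From mathcomp Require Import boolp classical_sets filter topology_structure.

Set Implicit Arguments.
Unset Strict Implicit.
Unset Printing Implicit Defensive.

Import Order.TTheory.

Local Open Scope classical_set_scope.

(* The neutral element 1 of the monoid is the greatest element \top of the
   bounded lattice, and 0 is \bot; the one-element algebra is allowed. *)
HB.mixin Record TBLattice_isBLAlgebra (d : Order.disp_t) L
    of Order.TBLattice d L := {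
  bl_mul : L -> L -> L;
  bl_imp : L -> L -> L;
  bl_mulA : associative bl_mul;
  bl_mulC : commutative bl_mul;
  bl_mul1x : left_id (\top%O : L) bl_mul;
  bl_residuation : forall a b c : L,
    (c <= bl_imp a b)%O <-> (bl_mul c a <= b)%O;
  bl_divisibility : forall a b : L, Order.meet a b = bl_mul a (bl_imp a b);
  bl_prelinearity : forall a b : L,
    Order.join (bl_imp a b) (bl_imp b a) = \top%O
}.

#[short(type="blAlgebraType")]
HB.structure Definition BLAlgebra (d : Order.disp_t) :=
  {L of TBLattice_isBLAlgebra d L & Order.TBLattice d L}.

Section StarOpen.
Context {d : Order.disp_t} {L : blAlgebraType d}.

Definition strongly_lt1 (a : L) : Prop :=
  forall b : L, Order.join a b = \top%O -> b = \top%O.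

Definition bl_equiv (a b : L) : L := bl_mul (bl_imp a b) (bl_imp b a).

Definition bl_equiv2 (a b : L * L) : L :=
  bl_mul (bl_equiv a.1 b.1) (bl_equiv a.2 b.2).

Definition star_ball (r a : L) : set L := [set b | (r < bl_equiv a b)%O].

Definition star_ball2 (r : L) (a : L * L) : set (L * L) :=
  [set b | (r < bl_equiv2 a b)%O].

Definition star_open : set (set L) :=
  [set G | forall a, G a ->
     exists r : L, strongly_lt1 r /\ star_ball r a `<=` G].

Definition star_open2 : set (set (L * L)) :=
  [set G | forall a, G a ->
     exists r : L, strongly_lt1 r /\ star_ball2 r a `<=` G].

End StarOpen.

Arguments star_open {d} L.
Arguments star_open2 {d} L.

(* [Topological X] is the type of topological space structures on the type X;
   the family T is a topology when it is the family of open sets of one. *)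
Definition is_topology (X : Type) (T : set (set X)) : Prop :=
  exists tX : Topological X, @open (Topological.Pack tX) = T.

(* Main.v *)
(* The radii strongly less than 1 contain 0 and are closed under joins, and the
   ball of radius [r \/ s] lies in the balls of radii [r] and [s]; hence finite
   intersections of open sets are open. One argument covers L and L^2. *)
Require Import Defs.
From mathcomp Require Import all_boot all_order.
From HB Require Import structures.
From mathcomp Require Import boolp classical_sets topology_structure.

Import Order.TTheory.
Local Open Scope classical_set_scope.

Section OpenAxioms.
Context (T : choiceType) (op : set (set T)).
Context (opT : op setT) (opI : setI_closed op).
Context (op_bigU : forall (I : Type) (f : I -> set T),
  (forall i, op (f i)) -> op (\bigcup_i f i)).

(** A separate name for the carrier, as the key of the new topological instance. *)
Let X : Type := T.
HB.instance Definition _ := Choice.on X.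
HB.instance Definition _ := isOpenTopological.Build X opT opI op_bigU.

(** The structure built on [X] takes [op] itself as its open sets, so the required equality holds by
    computation. *)
Lemma is_topology_open_axioms : is_topology op.
Proof. by exists (Topological.on X). Qed.

End OpenAxioms.

Section StarTopology.
Context {d : Order.disp_t} {L : blAlgebraType d}.

Lemma strongly_lt1_bot : strongly_lt1 (\bot%O : L).
Proof. by move=> b; rewrite join0x. Qed.

(** If r \/ (s \/ b) = 1, the property of r gives s \/ b = 1, and then that of s gives b = 1. *)
Lemma strongly_lt1_join (r s : L) :
  strongly_lt1 r -> strongly_lt1 s -> strongly_lt1 (Order.join r s).
Proof. by move=> hr hs b; rewrite -joinA => /hr/hs. Qed.

Lemma is_topology_value_balls (X : choiceType) (e : X -> X -> L) :
  is_topology [set G : set X | forall a, G a ->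
    exists r : L, strongly_lt1 r /\ [set b | (r < e a b)%O] `<=` G].
Proof.
apply: is_topology_open_axioms => [a _|A B hA hB a [Aa Ba]|I f hf a [i _ fia]].
(* The whole set contains every ball, so it is enough that some radius exists. *)
- by exists \bot%O; split; first exact: strongly_lt1_bot.
- have [[r [hr rA]] [s [hs sB]]] := (hA a Aa, hB a Ba).
  exists (Order.join r s); split; first exact: strongly_lt1_join.
  move=> b /= rs_lt; split; [apply: rA | apply: sB].
  + exact: le_lt_trans (leUl _ _) rs_lt.
  + exact: le_lt_trans (leUr _ _) rs_lt.
(* A radius for the member [f i] that contains [a] also serves the union. *)
- have [r [hr rf]] := hf i a fia.
  by exists r; split=> // b /rf fib; exists i.
Qed.

End StarTopology.

Theorem theorem3p5 (d : Order.disp_t) (L : blAlgebraType d) :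
  is_topology (star_open L) /\ is_topology (star_open2 L).
Proof.
split; first exact: (is_topology_value_balls L bl_equiv).
exact: (is_topology_value_balls (L * L)%type bl_equiv2).
Qed.
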